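(* For any $\epsilon>0$ there exists an embedded minimal Legendrian torus $T$ in $S^5(1)$ which is not flat, but for which $\sup_{x\in T}|K(x)|<\epsilon$, where $K$ is the Gauss curvature of $T$ (in the metric induced from the unit sphere $S^5(1)\subset\mathbb{C}^3$).
   Context: A surface in the unit sphere $S^5(1)\subset\mathbb{C}^3$ is Legendrian if the contact form $\iota_X\omega|_{S^5}$ vanishes on it, where $X$ is the Euler (radial) vector field and $\omega=\sum dx^i\wedge dy^i$ is the standard symplectic form on $\mathbb{C}^3$. Minimal means zero mean curvature in $S^5(1)$. *)

(* Defs.v *)
From Stdlib Require Import Reals ZArith.
From Coquelicot Require Import Coquelicot.
Open Scope R_scope.

(** * The Hermitian space C^3 = R^6 *)

Inductive axis := ax1 | ax2 | ax3.

Definition C3 := axis -> C.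

Definition sum_axis (f : axis -> R) : R := f ax1 + f ax2 + f ax3.

Definition vadd (v w : C3) : C3 := fun j => Cplus (v j) (w j).
Definition vopp (v : C3) : C3 := fun j => Copp (v j).
Definition vscal (a : R) (v : C3) : C3 := fun j => Cmult (RtoC a) (v j).
Definition vzero : C3 := fun _ => RtoC 0.

(* The Euclidean inner product of R^6, i.e. the real part of the Hermitian
   product. *)
Definition dot (v w : C3) : R :=
  sum_axis (fun j => Re (v j) * Re (w j) + Im (v j) * Im (w j)).

Definition vnorm (v : C3) : R := sqrt (dot v v).

(* With z^j = x^j + i y^j, this is sum_j dx^j /\ dy^j. *)
Definition omega (v w : C3) : R :=
  sum_axis (fun j => Re (v j) * Im (w j) - Im (v j) * Re (w j)).

(* The Euler vector field is X(p) = p, so i_X omega at p is v |-> omega(p, v);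
   the contact form is its restriction to the unit sphere. *)
Definition contact_form (p v : C3) : R := omega p v.

(** * Parametrized surfaces in C^3 *)

Inductive dir := du | dv.

Definition sum_dir (f : dir -> R) : R := f du + f dv.

Definition pderiv (i : dir) (f : R -> R -> R) (s t : R) : R :=
  match i with
  | du => Derive (fun z => f z t) s
  | dv => Derive (fun z => f s z) t
  end.

Definition D (i : dir) (F : R -> R -> C3) (s t : R) : C3 :=
  fun j => (pderiv i (fun s t => Re (F s t j)) s t,
            pderiv i (fun s t => Im (F s t j)) s t).

(* [Derive] is a junk value where the derivative does not exist; everything
   below is only used for smooth F. *)
Definition smooth (F : R -> R -> C3) : Prop :=
  forall (j : axis) (n : nat) (s t : R),
    ex_diff_n (fun s t => Re (F s t j)) n s t /\
    ex_diff_n (fun s t => Im (F s t j)) n s t.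

Definition immersion (F : R -> R -> C3) : Prop :=
  forall s t a b : R,
    (forall j, vadd (vscal a (D du F s t)) (vscal b (D dv F s t)) j = vzero j) ->
    a = 0 /\ b = 0.

(** * Embedded tori

    A torus is R^2 / L with L = Z (a1, a2) + Z (b1, b2) a lattice, and a map
    on the torus is an L-periodic map on R^2. *)

Definition periodic (a1 a2 b1 b2 : R) (F : R -> R -> C3) : Prop :=
  forall (s t : R) (m n : Z) (j : axis),
    F (s + IZR m * a1 + IZR n * b1) (t + IZR m * a2 + IZR n * b2) j = F s t j.

Definition injective_mod (a1 a2 b1 b2 : R) (F : R -> R -> C3) : Prop :=
  forall s t s' t' : R,
    (forall j, F s t j = F s' t' j) ->
    exists m n : Z,
      s' = s + IZR m * a1 + IZR n * b1 /\ t' = t + IZR m * a2 + IZR n * b2.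

(* Continuity of the inverse map from the image of F, with the subspace
   topology of C^3, to R^2 / L with the quotient topology. *)
Definition inverse_continuous_mod (a1 a2 b1 b2 : R) (F : R -> R -> C3) : Prop :=
  forall (s t : R) (eps : posreal), exists delta : posreal,
    forall s' t' : R,
      vnorm (vadd (F s' t') (vopp (F s t))) < delta ->
      exists m n : Z,
        Rabs (s' - (s + IZR m * a1 + IZR n * b1)) < eps /\
        Rabs (t' - (t + IZR m * a2 + IZR n * b2)) < eps.

(* F induces a smooth embedding of some torus R^2 / L: an injective immersion
   which is a homeomorphism onto its image. *)
Definition embedded_torus (F : R -> R -> C3) : Prop :=
  smooth F /\ immersion F /\
  exists a1 a2 b1 b2 : R,
    a1 * b2 - a2 * b1 <> 0 /\
    periodic a1 a2 b1 b2 F /\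
    injective_mod a1 a2 b1 b2 F /\
    inverse_continuous_mod a1 a2 b1 b2 F.

Definition in_unit_sphere (F : R -> R -> C3) : Prop :=
  forall s t : R, vnorm (F s t) = 1.

Definition legendrian (F : R -> R -> C3) : Prop :=
  forall (s t : R) (i : dir), contact_form (F s t) (D i F s t) = 0.

(** * Intrinsic geometry of a metric g on a parameter domain *)

Definition metric := dir -> dir -> R -> R -> R.

Definition gdet (g : metric) (s t : R) : R :=
  g du du s t * g dv dv s t - g du dv s t * g dv du s t.

(* The inverse matrix g^{ij}. *)
Definition ginv (g : metric) (i j : dir) (s t : R) : R :=
  match i, j with
  | du, du => g dv dv s t / gdet g s t
  | dv, dv => g du du s t / gdet g s t
  | du, dv => - g du dv s t / gdet g s t
  | dv, du => - g dv du s t / gdet g s t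
  end.

(* [christoffel g k i j] is Gamma^k_{ij}. *)
Definition christoffel (g : metric) (k i j : dir) (s t : R) : R :=
  / 2 * sum_dir (fun l => ginv g k l s t *
    (pderiv i (g j l) s t + pderiv j (g i l) s t - pderiv l (g i j) s t)).

(* [riemann g l i j k] is the d_l-component of R(d_i, d_j) d_k, where
   R(X, Y) Z = nabla_X nabla_Y Z - nabla_Y nabla_X Z - nabla_[X,Y] Z. *)
Definition riemann (g : metric) (l i j k : dir) (s t : R) : R :=
  pderiv i (christoffel g l j k) s t - pderiv j (christoffel g l i k) s t
  + sum_dir (fun m =>
      christoffel g l i m s t * christoffel g m j k s t
      - christoffel g l j m s t * christoffel g m i k s t).

(* g(R(d_u, d_v) d_v, d_u) / det g *)
Definition gauss_curvature_of (g : metric) (s t : R) : R :=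
  sum_dir (fun l => g l du s t * riemann g l du dv dv s t) / gdet g s t.

(** * Geometry of a surface in the unit sphere *)

Definition induced_metric (F : R -> R -> C3) : metric :=
  fun i j s t => dot (D i F s t) (D j F s t).

Definition gauss_curvature (F : R -> R -> C3) : R -> R -> R :=
  gauss_curvature_of (induced_metric F).

Definition flat (F : R -> R -> C3) : Prop :=
  forall s t : R, gauss_curvature F s t = 0.

Definition tangent_part (F : R -> R -> C3) (s t : R) (w : C3) : C3 :=
  let g := induced_metric F in
  let c i := sum_dir (fun j => ginv g i j s t * dot w (D j F s t)) in
  vadd (vscal (c du) (D du F s t)) (vscal (c dv) (D dv F s t)).

(* The second fundamental form of the surface in S^5: the component of
   d_i d_j F orthogonal to the surface and to the unit normal F of S^5. *)
Definition second_fundamental_form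
    (F : R -> R -> C3) (i j : dir) (s t : R) : C3 :=
  let w := D i (D j F) s t in
  vadd w (vopp (vadd (tangent_part F s t w) (vscal (dot w (F s t)) (F s t)))).

Definition mean_curvature (F : R -> R -> C3) (s t : R) : C3 :=
  let g := induced_metric F in
  let II := second_fundamental_form F in
  vscal (/ 2)
    (vadd (vadd (vscal (ginv g du du s t) (II du du s t))
                (vscal (ginv g du dv s t) (II du dv s t)))
          (vadd (vscal (ginv g dv du s t) (II dv du s t))
                (vscal (ginv g dv dv s t) (II dv dv s t)))).

Definition minimal (F : R -> R -> C3) : Prop :=
  forall (s t : R) (j : axis), mean_curvature F s t j = vzero j.

(* Extended-real supremum, so that no boundedness is presupposed. *)
Definition sup_abs_curvature (F : R -> R -> C3) : Rbar :=
  Lub_Rbar (fun k => exists s t : R, k = Rabs (gauss_curvature F s t)).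

(* Main.v *)
Require Import Defs.
From Stdlib Require Import Reals ZArith Lra Lia FunctionalExtensionality.
From Coquelicot Require Import Coquelicot.
(* Coquelicot's automatic differentiation exports a constructor [D]. *)
Import Defs.
Open Scope R_scope.

(** For a positive integer m take the frequencies a = (m, m + 1, -(2m + 1)) and the
    real curve w on the unit sphere of R^3 cut out by the quadric a1 w1^2 + a2 w2^2 + a3 w3^2 = 0.
    The orbit F(s,t) = (w_j(s) e^{i a_j t})_j is Legendrian because w is real and
    sum_j a_j w_j^2 = 0.  It is minimal because w, w' and the vector (a_j w_j) are mutually
    orthogonal, so that the mean curvature has a single component to check.
    Parametrizing the closed curve by (w1, w2) = (alpha cos s, beta sin s), which leaves
    w3 > 0, makes everything explicit: with x = sin^2 s and P = m(3m + 2) + (2m + 1)x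
    the metric is G (ds^2 / P + dt^2), where G = (2m + 1)(m + x).  The limiting case
    a = (1, 1, -2) is the flat torus; here the curvature is nonzero at s = 0 and O(1/m).
    There is no period problem: F is periodic for the lattice 2 pi Z^2, and it is
    an embedding since e^{it} and e^{is} are recovered continuously from the image. *)

(** * Calculus of vectors with rotating phases *)

Definition wave (a : axis -> R) (u : axis -> R -> R) (s t : R) : C3 :=
  fun j => (u j s * cos (a j * t), u j s * sin (a j * t)).

(** This is i times [wave]. The two families together are closed under both partial derivatives, and
    their inner products reduce to sums over the real amplitudes, free of t. *)
Definition iwave (a : axis -> R) (u : axis -> R -> R) (s t : R) : C3 :=
  fun j => (- (u j s * sin (a j * t)), u j s * cos (a j * t)).

Lemma Derive_cos_lin (k t : R) : Derive (fun z => cos (k * z)) t = - (k * sin (k * t)).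
Proof. apply is_derive_unique; auto_derive; [easy | ring]. Qed.

Lemma Derive_sin_lin (k t : R) : Derive (fun z => sin (k * z)) t = k * cos (k * t).
Proof. apply is_derive_unique; auto_derive; [easy | ring]. Qed.

Lemma D_du_wave a u : D du (wave a u) = wave a (fun j => Derive (u j)).
Proof.
extensionality s; extensionality t; extensionality j.
unfold D, wave, pderiv; simpl; now rewrite !Derive_scal_l.
Qed.

Lemma D_dv_wave a u : D dv (wave a u) = iwave a (fun j s => a j * u j s).
Proof.
extensionality s; extensionality t; extensionality j.
unfold D, wave, iwave, pderiv; simpl.
rewrite !Derive_scal, Derive_cos_lin, Derive_sin_lin; f_equal; ring.
Qed.

Lemma D_dv_iwave a u : D dv (iwave a u) = wave a (fun j s => - (a j * u j s)).
Proof.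
extensionality s; extensionality t; extensionality j.
unfold D, wave, iwave, pderiv; simpl.
rewrite Derive_opp, !Derive_scal, Derive_cos_lin, Derive_sin_lin; f_equal; ring.
Qed.

Lemma Rmult_cos_sin_sum (x y k : R) :
  x * cos k * (y * cos k) + x * sin k * (y * sin k) = x * y.
Proof.
transitivity (x * y * (Rsqr (sin k) + Rsqr (cos k))); [unfold Rsqr; ring | rewrite sin2_cos2; ring].
Qed.

Lemma dot_wave a u v s t : dot (wave a u s t) (wave a v s t) = sum_axis (fun j => u j s * v j s).
Proof. unfold dot, sum_axis, wave; simpl; now rewrite !Rmult_cos_sin_sum. Qed.

Lemma dot_iwave a u v s t : dot (iwave a u s t) (iwave a v s t) = sum_axis (fun j => u j s * v j s).
Proof.
unfold dot, sum_axis, iwave; simpl.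
rewrite <- (Rmult_cos_sin_sum (u ax1 s) (v ax1 s) (a ax1 * t)),
 <- (Rmult_cos_sin_sum (u ax2 s) (v ax2 s) (a ax2 * t)),
 <- (Rmult_cos_sin_sum (u ax3 s) (v ax3 s) (a ax3 * t)); ring.
Qed.

Lemma dot_wave_iwave a u v s t : dot (wave a u s t) (iwave a v s t) = 0.
Proof. unfold dot, sum_axis, wave, iwave; simpl; ring. Qed.

Lemma dot_iwave_wave a u v s t : dot (iwave a u s t) (wave a v s t) = 0.
Proof. unfold dot, sum_axis, wave, iwave; simpl; ring. Qed.

Lemma omega_wave a u v s t : omega (wave a u s t) (wave a v s t) = 0.
Proof. unfold omega, sum_axis, wave; simpl; ring. Qed.

Lemma omega_wave_iwave a u v s t :
  omega (wave a u s t) (iwave a v s t) = sum_axis (fun j => u j s * v j s).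
Proof.
unfold omega, sum_axis, wave, iwave; simpl.
rewrite <- (Rmult_cos_sin_sum (u ax1 s) (v ax1 s) (a ax1 * t)),
 <- (Rmult_cos_sin_sum (u ax2 s) (v ax2 s) (a ax2 * t)),
 <- (Rmult_cos_sin_sum (u ax3 s) (v ax3 s) (a ax3 * t)); ring.
Qed.

(** * The profile curve *)

(** The frequencies sum to zero, which is what lies behind minimality, and they are integers when m
    is, which closes the orbits in t. *)
Definition freq (m : R) (j : axis) : R :=
  match j with ax1 => m | ax2 => m + 1 | ax3 => - (2 * m + 1) end.

Definition quad (m s : R) : R := m * (3 * m + 2) + (2 * m + 1) * (sin s * sin s).

(** Eliminating w3 between the sphere and the quadric leaves the ellipse (3m + 1) w1^2 + (3m + 2)
    w2^2 = 2m + 1, whose semi-axes are the two constants; the third entry is the positive root of 1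
    - w1^2 - w2^2. *)
Definition profile (m : R) (j : axis) (s : R) : R :=
  match j with
  | ax1 => sqrt ((2 * m + 1) / (3 * m + 1)) * cos s
  | ax2 => sqrt ((2 * m + 1) / (3 * m + 2)) * sin s
  | ax3 => sqrt (quad m s / ((3 * m + 1) * (3 * m + 2)))
  end.

(** The third entries here and in [profile2] come from differentiating w3^2 once and twice and
    solving for w3' and w3'', so that the only square root left in them is w3 itself. *)
Definition profile1 (m : R) (j : axis) (s : R) : R :=
  match j with
  | ax1 => - (sqrt ((2 * m + 1) / (3 * m + 1)) * sin s)
  | ax2 => sqrt ((2 * m + 1) / (3 * m + 2)) * cos s
  | ax3 => (2 * m + 1) * (sin s * cos s) / ((3 * m + 1) * (3 * m + 2)) / profile m ax3 s
  end.

Definition profile2 (m : R) (j : axis) (s : R) : R :=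
  match j with
  | ax1 => - (sqrt ((2 * m + 1) / (3 * m + 1)) * cos s)
  | ax2 => - (sqrt ((2 * m + 1) / (3 * m + 2)) * sin s)
  | ax3 => ((2 * m + 1) * (cos s * cos s - sin s * sin s) / ((3 * m + 1) * (3 * m + 2))
            - profile1 m ax3 s * profile1 m ax3 s) / profile m ax3 s
  end.

Lemma cos_sqr_sin (s : R) : cos s * cos s = 1 - sin s * sin s.
Proof. generalize (sin2_cos2 s); unfold Rsqr; lra. Qed.

Lemma sin_sqr_bounds (s : R) : 0 <= sin s * sin s <= 1.
Proof. generalize (cos_sqr_sin s) (Rle_0_sqr (sin s)) (Rle_0_sqr (cos s)); unfold Rsqr; lra. Qed.

Lemma quad_pos m s : 1 <= m -> 0 < quad m s.
Proof. intros Hm; unfold quad; generalize (sin_sqr_bounds s); nra. Qed.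

Lemma profile3_pos m s : 1 <= m -> 0 < profile m ax3 s.
Proof.
intros Hm; apply sqrt_lt_R0, Rdiv_lt_0_compat; [now apply quad_pos | nra].
Qed.

Lemma profile3_sqr m s : 1 <= m ->
  profile m ax3 s * profile m ax3 s = quad m s / ((3 * m + 1) * (3 * m + 2)).
Proof.
intros Hm; apply sqrt_sqrt, Rlt_le, Rdiv_lt_0_compat; [now apply quad_pos | nra].
Qed.

Lemma sqrt_ratio_sqr m k : 1 <= m -> 1 <= k ->
  sqrt ((2 * m + 1) / (3 * m + k)) * sqrt ((2 * m + 1) / (3 * m + k)) = (2 * m + 1) / (3 * m + k).
Proof. intros Hm Hk; apply sqrt_sqrt, Rlt_le, Rdiv_lt_0_compat; lra. Qed.

Lemma is_derive_profile m j s : 1 <= m -> is_derive (profile m j) s (profile1 m j s).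
Proof.
intros Hm; destruct j; unfold profile1, profile.
- auto_derive; [easy | ring].
- auto_derive; [easy | ring].
- assert (Hq := quad_pos m s Hm); unfold quad in *.
  assert (H := profile3_pos m s Hm); unfold profile, quad in H.
  auto_derive.
  + repeat split; try nra. apply Rdiv_lt_0_compat; nra.
  + unfold Rdiv in *; field; split; [ | split]; try nra.
Qed.

Lemma is_derive_profile1 m j s : 1 <= m -> is_derive (profile1 m j) s (profile2 m j s).
Proof.
intros Hm; destruct j; unfold profile2.
- unfold profile1; auto_derive; [easy | ring].
- unfold profile1; auto_derive; [easy | ring].
- assert (H := profile3_pos m s Hm).
  evar_last.
  { apply is_derive_div; [ | now apply is_derive_profile | lra].
    auto_derive; [easy | reflexivity]. }
  cbn -[profile profile1]. unfold profile1. field; repeat split; lra.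
Qed.

Lemma Derive_profile m j : 1 <= m -> Derive (profile m j) = profile1 m j.
Proof. intros Hm; extensionality s; now apply is_derive_unique, is_derive_profile. Qed.

Lemma Derive_profile1 m j : 1 <= m -> Derive (profile1 m j) = profile2 m j.
Proof. intros Hm; extensionality s; now apply is_derive_unique, is_derive_profile1. Qed.

Definition metric_v (m s : R) : R := (2 * m + 1) * (m + sin s * sin s).

Definition metric_u (m s : R) : R := metric_v m s / quad m s.

Lemma metric_v_pos m s : 1 <= m -> 0 < metric_v m s.
Proof. intros Hm; unfold metric_v; generalize (sin_sqr_bounds s); nra. Qed.

Lemma metric_u_pos m s : 1 <= m -> 0 < metric_u m s.
Proof. intros Hm; apply Rdiv_lt_0_compat; [now apply metric_v_pos | now apply quad_pos]. Qed.

Lemma profile3_mul_profile1 m s : 1 <= m ->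
  profile m ax3 s * profile1 m ax3 s
  = (2 * m + 1) * (sin s * cos s) / ((3 * m + 1) * (3 * m + 2)).
Proof.
intros Hm; assert (H := profile3_pos m s Hm).
unfold profile1; field; repeat split; lra.
Qed.

Lemma profile3_mul_profile2 m s : 1 <= m ->
  profile m ax3 s * profile2 m ax3 s
  = (2 * m + 1) * (cos s * cos s - sin s * sin s) / ((3 * m + 1) * (3 * m + 2))
    - profile1 m ax3 s * profile1 m ax3 s.
Proof.
intros Hm; assert (H := profile3_pos m s Hm).
unfold profile2; field; repeat split; lra.
Qed.

(** Obtained as (w3 w3')^2 / w3^2, where numerator and denominator are free of square roots. *)
Lemma profile13_sqr m s : 1 <= m ->
  profile1 m ax3 s * profile1 m ax3 s
  = (2 * m + 1) * (2 * m + 1) * (sin s * sin s) * (1 - sin s * sin s)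
    / ((3 * m + 1) * (3 * m + 2) * quad m s).
Proof.
intros Hm; assert (H := profile3_pos m s Hm); assert (Hq := quad_pos m s Hm).
assert (H1 := profile3_sqr m s Hm); assert (H2 := profile3_mul_profile1 m s Hm).
rewrite <- cos_sqr_sin.
apply Rmult_eq_reg_l with (profile m ax3 s * profile m ax3 s); [ | nra].
transitivity ((profile m ax3 s * profile1 m ax3 s) * (profile m ax3 s * profile1 m ax3 s)); [ring | ].
rewrite H1, H2; field; repeat split; lra.
Qed.

Lemma profile12_sqr m s : 1 <= m ->
  profile m ax1 s * profile m ax1 s = (2 * m + 1) / (3 * m + 1) * (1 - sin s * sin s) /\
  profile m ax2 s * profile m ax2 s = (2 * m + 1) / (3 * m + 2) * (sin s * sin s).
Proof.
intros Hm; rewrite <- (sqrt_ratio_sqr m 1 Hm), <- (sqrt_ratio_sqr m 2 Hm), <- cos_sqr_sin by lra.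
unfold profile; split; ring.
Qed.

(** The weights stay arbitrary because three choices are used: k = 1 for the unit norm, k = a for
    the quadric and k = a^2 for the coefficient of dt^2. *)
Lemma profile_dot m (k : axis -> R) s : 1 <= m ->
  sum_axis (fun j => k j * (profile m j s * profile m j s))
  = k ax1 * ((2 * m + 1) / (3 * m + 1) * (1 - sin s * sin s))
    + k ax2 * ((2 * m + 1) / (3 * m + 2) * (sin s * sin s))
    + k ax3 * (quad m s / ((3 * m + 1) * (3 * m + 2))).
Proof.
intros Hm; unfold sum_axis; destruct (profile12_sqr m s Hm) as [-> ->].
now rewrite profile3_sqr.
Qed.

(** Applied with k = -a^2, this is the inner product of F_tt with F_s, that is, minus half the
    derivative of [metric_v]. *)
Lemma profile_dot_profile1 m (k : axis -> R) s : 1 <= m ->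
  sum_axis (fun j => k j * (profile m j s * profile1 m j s))
  = (2 * m + 1) * (sin s * cos s)
    * (- k ax1 / (3 * m + 1) + k ax2 / (3 * m + 2) + k ax3 / ((3 * m + 1) * (3 * m + 2))).
Proof.
intros Hm; unfold sum_axis; rewrite (profile3_mul_profile1 m s Hm).
transitivity (sin s * cos s * (k ax2 * (sqrt ((2 * m + 1) / (3 * m + 2)) * sqrt ((2 * m + 1) / (3 * m + 2))) -
  k ax1 * (sqrt ((2 * m + 1) / (3 * m + 1)) * sqrt ((2 * m + 1) / (3 * m + 1))))
  + k ax3 * ((2 * m + 1) * (sin s * cos s) / ((3 * m + 1) * (3 * m + 2)))).
- unfold profile, profile1; ring.
- rewrite !sqrt_ratio_sqr by lra; field; repeat split; lra.
Qed.

Lemma profile1_dot_profile1 m s : 1 <= m ->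
  sum_axis (fun j => profile1 m j s * profile1 m j s) = metric_u m s.
Proof.
intros Hm; unfold sum_axis; rewrite profile13_sqr by easy.
transitivity (sqrt ((2 * m + 1) / (3 * m + 1)) * sqrt ((2 * m + 1) / (3 * m + 1)) * (sin s * sin s)
  + sqrt ((2 * m + 1) / (3 * m + 2)) * sqrt ((2 * m + 1) / (3 * m + 2)) * (cos s * cos s)
  + (2 * m + 1) * (2 * m + 1) * (sin s * sin s) * (1 - sin s * sin s)
    / ((3 * m + 1) * (3 * m + 2) * quad m s)).
- unfold profile1; ring.
- assert (Hq := quad_pos m s Hm).
  rewrite !sqrt_ratio_sqr, cos_sqr_sin by lra; unfold metric_u, metric_v, quad in *.
  field; repeat split; lra.
Qed.

(** The value is half the derivative of [metric_u]. The third summand is found as (w3 w3') (w3 w3'')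
    / w3^2. *)
Lemma profile2_dot_profile1 m s : 1 <= m ->
  sum_axis (fun j => profile2 m j s * profile1 m j s)
  = (2 * m + 1) * m * (m + 1) * (sin s * cos s) / (quad m s * quad m s).
Proof.
intros Hm; assert (Hq := quad_pos m s Hm).
assert (H3 : profile2 m ax3 s * profile1 m ax3 s
  = (2 * m + 1) * (sin s * cos s)
    * ((2 * m + 1) * (1 - 2 * (sin s * sin s)) / ((3 * m + 1) * (3 * m + 2))
    - (2 * m + 1) * (2 * m + 1) * (sin s * sin s) * (1 - sin s * sin s)
    / ((3 * m + 1) * (3 * m + 2) * quad m s)) / quad m s).
{ assert (H := profile3_pos m s Hm).
  apply Rmult_eq_reg_l with (profile m ax3 s * profile m ax3 s); [ | nra].
  transitivity ((profile m ax3 s * profile1 m ax3 s) * (profile m ax3 s * profile2 m ax3 s)); [ring | ].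
  rewrite profile3_mul_profile2, profile3_mul_profile1, profile3_sqr, profile13_sqr, cos_sqr_sin by easy.
  field; repeat split; lra. }
unfold sum_axis; rewrite H3.
transitivity (sin s * cos s * (sqrt ((2 * m + 1) / (3 * m + 1)) * sqrt ((2 * m + 1) / (3 * m + 1))
  - sqrt ((2 * m + 1) / (3 * m + 2)) * sqrt ((2 * m + 1) / (3 * m + 2)))
  + (2 * m + 1) * (sin s * cos s)
    * ((2 * m + 1) * (1 - 2 * (sin s * sin s)) / ((3 * m + 1) * (3 * m + 2))
    - (2 * m + 1) * (2 * m + 1) * (sin s * sin s) * (1 - sin s * sin s)
    / ((3 * m + 1) * (3 * m + 2) * quad m s)) / quad m s).
- unfold profile1, profile2; ring.
- rewrite !sqrt_ratio_sqr by lra; unfold quad in *; field; repeat split; lra.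
Qed.

(** Differentiating <w, w'> = 0 explains the value; the proof checks it in coordinates. *)
Lemma profile2_dot_profile m s : 1 <= m ->
  sum_axis (fun j => profile2 m j s * profile m j s) = - metric_u m s.
Proof.
intros Hm; rewrite <- profile1_dot_profile1 by easy.
unfold sum_axis; rewrite (Rmult_comm (profile2 m ax3 s)), profile3_mul_profile2 by easy.
transitivity (- (sqrt ((2 * m + 1) / (3 * m + 1)) * sqrt ((2 * m + 1) / (3 * m + 1)) * (cos s * cos s)
  + sqrt ((2 * m + 1) / (3 * m + 2)) * sqrt ((2 * m + 1) / (3 * m + 2)) * (sin s * sin s))
  + ((2 * m + 1) * (cos s * cos s - sin s * sin s) / ((3 * m + 1) * (3 * m + 2))
    - profile1 m ax3 s * profile1 m ax3 s)).
- unfold profile2, profile; ring.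
- transitivity (- (sqrt ((2 * m + 1) / (3 * m + 1)) * sqrt ((2 * m + 1) / (3 * m + 1)) * (sin s * sin s)
  + sqrt ((2 * m + 1) / (3 * m + 2)) * sqrt ((2 * m + 1) / (3 * m + 2)) * (cos s * cos s)
    + profile1 m ax3 s * profile1 m ax3 s)).
  + rewrite !sqrt_ratio_sqr, cos_sqr_sin by lra; field; lra.
  + unfold profile1; ring.
Qed.

(** The left side is the j-th amplitude of twice the mean curvature: 2w is the radial correction and
    the multiple of w' the tangential one. In the orthogonal frame w, w', (a_j w_j) its first two
    components cancel by these corrections, and the inner product with the third vector is minus the
    trace of diag(a), hence zero. The proof verifies the identity coordinate by coordinate. *)
Lemma profile_balance m j s : 1 <= m ->
  profile2 m j s / metric_u m s - freq m j * (freq m j * profile m j s) / metric_v m s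
  + 2 * profile m j s
  + ((2 * m + 1) * (sin s * cos s) / metric_v m s
     - (2 * m + 1) * m * (m + 1) * (sin s * cos s) / (quad m s * quad m s) / metric_u m s)
    / metric_u m s * profile1 m j s = 0.
Proof.
intros Hm; assert (Hq := quad_pos m s Hm); assert (Hv := metric_v_pos m s Hm).
destruct j.
(* Every summand contains w1; once it is pulled out, the cofactor vanishes as a rational function of
   m and sin s. *)
- transitivity (sqrt ((2 * m + 1) / (3 * m + 1)) * cos s *
   (- (1) / metric_u m s - m * m / metric_v m s + 2
   - ((2 * m + 1) * (sin s * sin s) / metric_v m s
     - (2 * m + 1) * m * (m + 1) * (sin s * sin s) / (quad m s * quad m s) / metric_u m s)
    / metric_u m s)).
  + unfold profile2, profile1, profile, freq, metric_u; field; lra.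
  + unfold metric_u, metric_v, quad in *; field; repeat split; nra.
- transitivity (sqrt ((2 * m + 1) / (3 * m + 2)) * sin s *
   (- (1) / metric_u m s - (m + 1) * (m + 1) / metric_v m s + 2
   + ((2 * m + 1) * (cos s * cos s) / metric_v m s
     - (2 * m + 1) * m * (m + 1) * (cos s * cos s) / (quad m s * quad m s) / metric_u m s)
    / metric_u m s)).
  + unfold profile2, profile1, profile, freq, metric_u; field; lra.
  + rewrite cos_sqr_sin; unfold metric_u, metric_v, quad in *; field; repeat split; nra.
- assert (H := profile3_pos m s Hm).
  (* Multiplying by w3 > 0 leaves only w3^2, w3 w3' and w3 w3'', all known without square roots. *)
  apply Rmult_eq_reg_l with (profile m ax3 s); [ | lra].
  transitivity (profile m ax3 s * profile2 m ax3 s / metric_u m s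
   - (2 * m + 1) * (2 * m + 1) * (profile m ax3 s * profile m ax3 s) / metric_v m s
   + 2 * (profile m ax3 s * profile m ax3 s)
   + ((2 * m + 1) * (sin s * cos s) / metric_v m s
     - (2 * m + 1) * m * (m + 1) * (sin s * cos s) / (quad m s * quad m s) / metric_u m s)
    / metric_u m s * (profile m ax3 s * profile1 m ax3 s)).
  + unfold freq, metric_u; field; lra.
  + rewrite profile3_mul_profile2, profile13_sqr, profile3_sqr, profile3_mul_profile1 by easy.
    transitivity (((2 * m + 1) * (1 - 2 * (sin s * sin s)) / ((3 * m + 1) * (3 * m + 2)) -
    (2 * m + 1) * (2 * m + 1) * (sin s * sin s) * (1 - sin s * sin s) /
    ((3 * m + 1) * (3 * m + 2) * quad m s)) / metric_u m s -
   (2 * m + 1) * (2 * m + 1) * (quad m s / ((3 * m + 1) * (3 * m + 2))) / metric_v m s +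
   2 * (quad m s / ((3 * m + 1) * (3 * m + 2))) +
   ((2 * m + 1) / metric_v m s -
    (2 * m + 1) * m * (m + 1) / (quad m s * quad m s) / metric_u m s) / metric_u m s *
   ((2 * m + 1) * (sin s * sin s * (cos s * cos s)) / ((3 * m + 1) * (3 * m + 2)))).
    * rewrite cos_sqr_sin; unfold metric_u; field_simplify_eq; [ | repeat split; lra].
      replace (cos s ^ 2) with (1 - sin s * sin s) by (rewrite <- cos_sqr_sin; ring).
      ring.
    * rewrite cos_sqr_sin; unfold metric_u, metric_v, quad in *; field; repeat split; nra.
Qed.

(** * Metric, mean curvature and Gauss curvature *)

Definition diag_metric (E G : R -> R) : metric :=
  fun i j s _ => match i, j with du, du => E s | dv, dv => G s | _, _ => 0 end.

(** An equality of functions, because the Riemann tensor differentiates the symbols; hence E and G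
    must be nonzero at every point. *)
Lemma christoffel_diag E G k i j : (forall x, E x <> 0) -> (forall x, G x <> 0) ->
  christoffel (diag_metric E G) k i j
  = fun s _ => match k, i, j with
               | du, du, du => Derive E s / (2 * E s)
               | du, dv, dv => - (Derive G s / (2 * E s))
               | dv, du, dv | dv, dv, du => Derive G s / (2 * G s)
               | _, _, _ => 0
               end.
Proof.
intros HE HG; extensionality s; extensionality t.
unfold christoffel, sum_dir, ginv, gdet.
destruct k, i, j; unfold diag_metric, pderiv; cbn; rewrite !Derive_const;
  change (fun z : R => E z) with E; change (fun z : R => G z) with G; field; auto.
Qed.

(** Only the component R^u_{uvv} contributes. Its outer derivative stays unexpanded, since for the
    surface G' / (2E) simplifies before it is differentiated. *)
Lemma gauss_curvature_diag E G s t : (forall x, E x <> 0) -> (forall x, G x <> 0) ->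
  gauss_curvature_of (diag_metric E G) s t
  = (Derive (fun x => - (Derive G x / (2 * E x))) s
     - Derive E s * Derive G s / (4 * E s * E s)
     + Derive G s * Derive G s / (4 * E s * G s)) / G s.
Proof.
intros HE HG; unfold gauss_curvature_of, sum_dir, riemann, sum_dir, gdet.
rewrite !christoffel_diag by easy; unfold diag_metric, pderiv; cbn; rewrite !Derive_const.
field; auto.
Qed.

(** * The surface: sphere, contact condition, metric and minimality *)

Definition surface (m : R) : R -> R -> C3 := wave (freq m) (profile m).

Lemma D_du_surface m : 1 <= m -> D du (surface m) = wave (freq m) (profile1 m).
Proof.
intros Hm; unfold surface; rewrite D_du_wave; f_equal.
extensionality j; now apply Derive_profile.
Qed.

Lemma D_dv_surface m : D dv (surface m) = iwave (freq m) (fun j s => freq m j * profile m j s).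
Proof. apply D_dv_wave. Qed.

Lemma D_du_du_surface m : 1 <= m -> D du (D du (surface m)) = wave (freq m) (profile2 m).
Proof.
intros Hm; rewrite D_du_surface, D_du_wave by easy; f_equal.
extensionality j; now apply Derive_profile1.
Qed.

Lemma D_dv_dv_surface m :
  D dv (D dv (surface m))
  = wave (freq m) (fun j s => - (freq m j * (freq m j * profile m j s))).
Proof. now rewrite D_dv_surface, D_dv_iwave. Qed.

Lemma surface_norm m s t : 1 <= m -> dot (surface m s t) (surface m s t) = 1.
Proof.
intros Hm; unfold surface; rewrite dot_wave.
transitivity (sum_axis (fun j => 1 * (profile m j s * profile m j s))).
- unfold sum_axis; ring.
- rewrite profile_dot by easy; unfold quad; field; lra.
Qed.

Lemma surface_in_unit_sphere m : 1 <= m -> in_unit_sphere (surface m).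
Proof. intros Hm s t; unfold vnorm; rewrite surface_norm by easy; apply sqrt_1. Qed.

Lemma surface_legendrian m : 1 <= m -> legendrian (surface m).
Proof.
intros Hm s t [ | ]; unfold contact_form.
- rewrite D_du_surface by easy; apply omega_wave.
- rewrite D_dv_surface; unfold surface; rewrite omega_wave_iwave.
  transitivity (sum_axis (fun j => freq m j * (profile m j s * profile m j s))).
  + unfold sum_axis; ring.
  + rewrite profile_dot by easy; unfold quad, freq; field; lra.
Qed.

Lemma freq2_profile_dot m s : 1 <= m ->
  sum_axis (fun j => freq m j * (freq m j * profile m j s) * profile m j s) = metric_v m s.
Proof.
intros Hm.
transitivity (sum_axis (fun j => (freq m j * freq m j) * (profile m j s * profile m j s))).
- unfold sum_axis; ring.
- rewrite profile_dot by easy; unfold freq, quad, metric_v; field; lra.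
Qed.

Lemma surface_metric m : 1 <= m ->
  induced_metric (surface m) = diag_metric (metric_u m) (metric_v m).
Proof.
intros Hm; extensionality i; extensionality j; extensionality s; extensionality t.
unfold induced_metric, diag_metric; destruct i, j; rewrite ?D_du_surface, ?D_dv_surface by easy.
- rewrite dot_wave; now apply profile1_dot_profile1.
- apply dot_wave_iwave.
- apply dot_iwave_wave.
- rewrite dot_iwave, <- freq2_profile_dot by easy; unfold sum_axis; ring.
Qed.

(** Pairing a vanishing combination with F_s and with F_t gives a E = 0 and b G = 0, as the metric
    is diagonal with positive entries. *)
Lemma surface_immersion m : 1 <= m -> immersion (surface m).
Proof.
intros Hm s t a b H.
assert (Hdot : forall v w, (forall j, v j = vzero j) -> dot v w = 0).
{ intros v w Hv; unfold dot, sum_axis; rewrite !Hv; simpl; ring. }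
assert (Hlin : forall x v y w z,
  dot (vadd (vscal x v) (vscal y w)) z = x * dot v z + y * dot w z).
{ intros; unfold dot, sum_axis, vadd, vscal, Cplus, Cmult, Re, Im; simpl; ring. }
assert (Hu := Hdot _ (D du (surface m) s t) H); assert (Hv := Hdot _ (D dv (surface m) s t) H).
rewrite Hlin in Hu, Hv.
change (a * induced_metric (surface m) du du s t + b * induced_metric (surface m) dv du s t = 0) in Hu.
change (a * induced_metric (surface m) du dv s t + b * induced_metric (surface m) dv dv s t = 0) in Hv.
rewrite surface_metric in Hu, Hv by easy; simpl in Hu, Hv.
generalize (metric_u_pos m s Hm) (metric_v_pos m s Hm); intros; split; nra.
Qed.

Lemma surface_minimal m : 1 <= m -> minimal (surface m).
Proof.
intros Hm s t j.
assert (HE := metric_u_pos m s Hm); assert (HG := metric_v_pos m s Hm).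
assert (Hb := profile_balance m j s Hm).
unfold mean_curvature.
(* The mixed terms are multiplied by g^{uv} = 0, so their values may stay opaque. *)
generalize (second_fundamental_form (surface m) du dv s t)
  (second_fundamental_form (surface m) dv du s t); intros IIuv IIvu.
unfold second_fundamental_form, tangent_part.
rewrite surface_metric by easy.
unfold sum_dir, ginv, gdet, diag_metric.
rewrite D_du_du_surface, D_dv_dv_surface by easy.
rewrite (D_du_surface m Hm), (D_dv_surface m).
unfold surface.
rewrite !dot_wave, !dot_wave_iwave, profile2_dot_profile1, profile2_dot_profile by easy.
replace (sum_axis (fun j => - (freq m j * (freq m j * profile m j s)) * profile1 m j s))
  with (- ((2 * m + 1) * (sin s * cos s))).
2: { transitivity (sum_axis (fun j => - (freq m j * freq m j) * (profile m j s * profile1 m j s))).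
  - symmetry; rewrite profile_dot_profile1 by easy; unfold freq; field; lra.
  - unfold sum_axis; ring. }
replace (sum_axis (fun j => - (freq m j * (freq m j * profile m j s)) * profile m j s))
  with (- metric_v m s).
2: { rewrite <- freq2_profile_dot by easy; unfold sum_axis; ring. }
set (g1 := (2 * m + 1) * (sin s * cos s)) in *.
set (e1 := _ / (quad m s * quad m s)) in *.
set (E := metric_u m s) in *; set (G := metric_v m s) in *.
unfold vscal, vadd, vopp, vzero, wave, iwave, Cplus, Cmult, Copp, RtoC; cbn -[profile profile1 profile2 freq].
(* The real and imaginary parts are half of the balance expression times the cosine and the sine of
   the phase a_j t. *)
match type of Hb with ?h = 0 =>
  apply f_equal2; [transitivity (/ 2 * (h * cos (freq m j * t))) | transitivity (/ 2 * (h * sin (freq m j * t)))]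
end; [field; lra | rewrite Hb; ring | field; lra | rewrite Hb; ring].
Qed.

(** * Gauss curvature of the surface and its size *)

Lemma Derive_metric_v m : Derive (metric_v m) = fun s => 2 * (2 * m + 1) * (sin s * cos s).
Proof.
extensionality s; apply is_derive_unique; unfold metric_v; auto_derive; [easy | ring].
Qed.

Lemma Derive_metric_u m s : 1 <= m ->
  Derive (metric_u m) s = 2 * (2 * m + 1) * m * (m + 1) * (sin s * cos s) / (quad m s * quad m s).
Proof.
intros Hm; assert (Hq := quad_pos m s Hm).
apply is_derive_unique; unfold metric_u, metric_v, quad in *; auto_derive; [lra | field; lra].
Qed.

Lemma surface_curvature m s t : 1 <= m ->
  gauss_curvature (surface m) s t
  = - (quad m s * (2 * (1 - 2 * (sin s * sin s)) / (m + sin s * sin s)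
                  - 4 * (sin s * sin s) * (1 - sin s * sin s)
                    / ((m + sin s * sin s) * (m + sin s * sin s)))
       + 2 * (2 * m + 1) * (sin s * sin s) * (1 - sin s * sin s) / (m + sin s * sin s))
    / (2 * metric_v m s).
Proof.
intros Hm.
assert (Hn : forall x, 0 < m + sin x * sin x) by (intros x; generalize (sin_sqr_bounds x); lra).
assert (HD : Derive (fun x => - (Derive (metric_v m) x / (2 * metric_u m x))) s
  = - (quad m s * ((1 - 2 * (sin s * sin s)) / (m + sin s * sin s)
         - 2 * (sin s * sin s) * (1 - sin s * sin s) / ((m + sin s * sin s) * (m + sin s * sin s)))
       + 2 * (2 * m + 1) * (sin s * sin s) * (1 - sin s * sin s) / (m + sin s * sin s))).
{ rewrite Derive_metric_v.
  (* The common factor 2m + 1 of G' and G cancels, because [metric_u] is G / P. *)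
  replace (fun x => - (2 * (2 * m + 1) * (sin x * cos x) / (2 * metric_u m x)))
    with (fun x => - (sin x * cos x * quad m x / (m + sin x * sin x))).
  2: { extensionality x; unfold metric_u, metric_v; generalize (quad_pos m x Hm) (Hn x); intros.
    field; repeat split; nra. }
  apply is_derive_unique; unfold quad; auto_derive; [generalize (Hn s); lra | ].
  (* With 1 - sin^2 written as cos^2, the identity holds with sin and cos as independent variables,
     so [field] can close it. *)
  rewrite <- !cos_sqr_sin.
  replace (1 - 2 * (sin s * sin s)) with (cos s * cos s - sin s * sin s) by (rewrite cos_sqr_sin; ring).
  field; generalize (Hn s); lra. }
unfold gauss_curvature; rewrite surface_metric by easy.
rewrite gauss_curvature_diag.
2: intros x; generalize (metric_u_pos m x Hm); lra.
2: intros x; generalize (metric_v_pos m x Hm); lra.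
rewrite HD, Derive_metric_v, Derive_metric_u by easy.
rewrite <- !cos_sqr_sin.
replace (1 - 2 * (sin s * sin s)) with (cos s * cos s - sin s * sin s) by (rewrite cos_sqr_sin; ring).
assert (Hq := quad_pos m s Hm); specialize (Hn s).
unfold metric_u, metric_v, quad in *; field; repeat split; nra.
Qed.

Lemma surface_curvature_bound m s t : 1 <= m -> Rabs (gauss_curvature (surface m) s t) <= 10 / m.
Proof.
intros Hm; rewrite surface_curvature by easy.
unfold metric_v, quad.
generalize (sin_sqr_bounds s); set (x := sin s * sin s); intros Hx.
set (q := m * (3 * m + 2) + (2 * m + 1) * x); set (n := m + x).
assert (Hn : 0 < n) by (unfold n; lra).
assert (HA : 0 <= q / n <= 8 * m).
{ split; [apply Rlt_le, Rdiv_lt_0_compat; [unfold q; nra | easy] | ].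
  assert (m <= m * m) by nra; assert (0 <= m * x) by nra.
  apply Rle_div_l; unfold q, n in *; lra. }
assert (HA' : 0 <= q / n / n <= 8).
{ split; [apply Rmult_le_pos; [easy | now apply Rlt_le, Rinv_0_lt_compat] | ].
  assert (m <= n) by (unfold n; lra); apply Rle_div_l; lra. }
assert (HB : 0 <= (2 * m + 1) / n <= 3).
{ split; [apply Rlt_le, Rdiv_lt_0_compat; lra | apply Rle_div_l; unfold n; lra]. }
(* Since x (1 - x) <= 1/4, the three terms are at most 16m, 8 and 2; m >= 1 turns their sum into
   26m. *)
assert (HN : Rabs (2 * (q / n) * (1 - 2 * x) - 4 * (q / n / n) * (x * (1 - x))
  + 2 * ((2 * m + 1) / n) * (x * (1 - x))) <= 26 * m).
{ assert (0 <= x * (1 - x) <= / 4) by (generalize (Rle_0_sqr (x - / 2)); unfold Rsqr; nra).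
  revert HA HA' HB; generalize (q / n) (q / n / n) ((2 * m + 1) / n); intros a b c Ha Hb Hc.
  assert (Rabs (2 * a * (1 - 2 * x)) <= 16 * m) by (apply Rabs_le; nra).
  assert (Rabs (- (4 * b * (x * (1 - x)))) <= 8) by (apply Rabs_le; nra).
  assert (Rabs (2 * c * (x * (1 - x))) <= 2) by (apply Rabs_le; nra).
  eapply Rle_trans; [apply Rabs_triang | ].
  eapply Rle_trans; [apply Rplus_le_compat_r, Rabs_triang | lra]. }
match goal with |- Rabs ?k <= _ =>
  replace k with (- (2 * (q / n) * (1 - 2 * x) - 4 * (q / n / n) * (x * (1 - x))
    + 2 * ((2 * m + 1) / n) * (x * (1 - x))) / (2 * ((2 * m + 1) * n))) by (field; lra)
end.
(* With this lower bound for the denominator the quotient is at most 26 / (4m), which is below 10 /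
   m. *)
assert (Hd : 4 * (m * m) <= 2 * ((2 * m + 1) * n)) by (unfold n; nra).
rewrite Rabs_div, Rabs_Ropp, (Rabs_pos_eq (2 * _)) by nra.
apply Rle_div_l; [nra | ].
eapply Rle_trans; [exact HN | ].
apply Rle_trans with (10 / m * (4 * (m * m))); [ | apply Rmult_le_compat_l; [ | easy]].
- replace (10 / m * (4 * (m * m))) with (40 * m) by (field; lra); lra.
- apply Rlt_le, Rdiv_lt_0_compat; lra.
Qed.

Lemma surface_not_flat m : 1 <= m -> ~ flat (surface m).
Proof.
intros Hm Hf; specialize (Hf 0 0); rewrite surface_curvature in Hf by easy.
unfold metric_v, quad in Hf; rewrite sin_0 in Hf.
(* The left side is the curvature at the origin: only the term with 1 - 2 sin^2 s survives there,
   and P = m (3m + 2). *)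
assert (H : - (3 * m + 2) / (m * (2 * m + 1)) = 0) by (rewrite <- Hf; field; lra).
assert (- (3 * m + 2) = 0); [ | lra].
replace (- (3 * m + 2)) with (- (3 * m + 2) / (m * (2 * m + 1)) * (m * (2 * m + 1))) by (field; lra).
rewrite H; ring.
Qed.

Lemma surface_sup_abs_curvature m : 1 <= m -> Rbar_le (sup_abs_curvature (surface m)) (10 / m).
Proof.
intros Hm; apply Lub_Rbar_correct; intros k (s & t & ->); now apply surface_curvature_bound.
Qed.

(** * Smoothness *)

(** The index is shifted by one: [Ck 0] already asks for differentiability, so that [Ck n] makes all
    derivatives up to order n continuous. *)
Fixpoint Ck (n : nat) (f : R -> R) : Prop :=
  (forall x, ex_derive f x) /\ match n with O => True | S k => Ck k (Derive f) end.

Lemma Ck_ex_derive n f : Ck n f -> forall x, ex_derive f x.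
Proof. destruct n; now intros [H _]. Qed.

Lemma Ck_S n f : Ck (S n) f -> Ck n f.
Proof.
revert f; induction n as [ | n IHn]; intros f [H1 H2]; split; try easy.
now apply IHn.
Qed.

Lemma Ck_const n c : Ck n (fun _ => c).
Proof.
revert c; induction n as [ | n IHn]; intros c; split; try easy; try (intros; apply ex_derive_const).
replace (Derive (fun _ => c)) with (fun _ : R => 0); [apply IHn | ].
extensionality x; now rewrite Derive_const.
Qed.

Lemma Ck_plus n f g : Ck n f -> Ck n g -> Ck n (fun x => f x + g x).
Proof.
revert f g; induction n as [ | n IHn]; intros f g [Hf Hf'] [Hg Hg']; split; try easy;
  try (intros x; now apply (ex_derive_plus (V := R_NormedModule))).
replace (Derive _) with (fun x => Derive f x + Derive g x); [now apply IHn | ].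
extensionality x; now rewrite Derive_plus.
Qed.

Lemma Ck_mult n f g : Ck n f -> Ck n g -> Ck n (fun x => f x * g x).
Proof.
revert f g; induction n as [ | n IHn]; intros f g Hf Hg.
- destruct Hf as [Hf _], Hg as [Hg _]; split; [ | easy]; intros x; now apply ex_derive_mult.
- assert (Hf0 := Ck_ex_derive _ _ Hf); assert (Hg0 := Ck_ex_derive _ _ Hg).
  assert (Hf1 := Ck_S _ _ Hf); assert (Hg1 := Ck_S _ _ Hg).
  split; [intros x; now apply ex_derive_mult | ].
  replace (Derive _) with (fun x => Derive f x * g x + f x * Derive g x).
  + apply Ck_plus; apply IHn; now try apply Hf; try apply Hg.
  + extensionality x; now rewrite Derive_mult.
Qed.

Lemma Ck_opp n f : Ck n f -> Ck n (fun x => - f x).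
Proof.
intros Hf; replace (fun x => - f x) with (fun x => -1 * f x) by (extensionality x; ring).
apply Ck_mult; [apply Ck_const | easy].
Qed.

(** The derivative is -f' (1/f)^2, and 1/f has the preceding order of regularity by induction. *)
Lemma Ck_inv n f : (forall x, f x <> 0) -> Ck n f -> Ck n (fun x => / f x).
Proof.
intros Hn; induction n as [ | n IHn]; intros Hf; assert (Hf0 := Ck_ex_derive _ _ Hf).
- split; [ | easy]; intros x; now apply ex_derive_inv.
- split; [intros x; now apply ex_derive_inv | ].
  specialize (IHn (Ck_S _ _ Hf)).
  replace (Derive _) with (fun x => (- Derive f x) * (/ f x * / f x)).
  + apply Ck_mult; [apply Ck_opp, Hf | now apply Ck_mult].
  + extensionality x; rewrite Derive_inv by easy; now field.
Qed.

(** Proved jointly, as each function is up to a constant the derivative of the other. *)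
Lemma Ck_trig n k : Ck n (fun x => cos (k * x)) /\ Ck n (fun x => sin (k * x)).
Proof.
induction n as [ | n [IHc IHs]].
- split; split; try easy; intros x; now auto_derive.
- split; (split; [intros x; now auto_derive | ]).
  + replace (Derive _) with (fun x => - k * sin (k * x)).
    * apply Ck_mult; [apply Ck_const | easy].
    * extensionality x; rewrite Derive_cos_lin; ring.
  + replace (Derive _) with (fun x => k * cos (k * x)).
    * apply Ck_mult; [apply Ck_const | easy].
    * extensionality x; now rewrite Derive_sin_lin.
Qed.

Lemma Ck_cos n : Ck n cos.
Proof.
replace cos with (fun x => cos (1 * x)) by (extensionality x; now rewrite Rmult_1_l).
apply Ck_trig.
Qed.

Lemma Ck_sin n : Ck n sin.
Proof.
replace sin with (fun x => sin (1 * x)) by (extensionality x; now rewrite Rmult_1_l).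
apply Ck_trig.
Qed.

(** For the third entry regularity bootstraps: w3' is a constant times sin cos / w3, so order n for
    w3 gives order n for w3', hence order n + 1 for w3. *)
Lemma Ck_profile m j n : 1 <= m -> Ck n (profile m j).
Proof.
intros Hm; destruct j.
- apply Ck_mult; [apply Ck_const | apply Ck_cos].
- apply Ck_mult; [apply Ck_const | apply Ck_sin].
- induction n as [ | n IHn].
  + split; [ | easy]; intros s; eexists; now apply is_derive_profile.
  + split; [intros s; eexists; now apply is_derive_profile | ].
    rewrite Derive_profile by easy; unfold profile1, Rdiv.
    apply Ck_mult; [ | apply Ck_inv; [ | easy]].
    * repeat apply Ck_mult; auto using Ck_const, Ck_cos, Ck_sin.
    * intros s; generalize (profile3_pos m s Hm); lra.
Qed.

(** Both partial derivatives of a product f(x) g(y) are again products of this form, so the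
    induction closes. *)
Lemma ex_diff_n_mult n f g s t : Ck n f -> Ck n g ->
  ex_diff_n (fun x y => f x * g y) n s t.
Proof.
assert (Hc : forall h, (forall x, ex_derive h x) -> forall x, continuity_pt h x).
{ intros h Hh x; now apply derivable_continuous_pt, ex_derive_Reals_0. }
revert f g; induction n as [ | n IHn]; intros f g Hf Hg;
  assert (Hf0 := Ck_ex_derive _ _ Hf); assert (Hg0 := Ck_ex_derive _ _ Hg);
  assert (H2 : continuity_2d_pt (fun x y => f x * g y) s t).
1, 3: apply continuity_2d_pt_mult;
  [apply (continuity_1d_2d_pt_comp f (fun x _ => x)) | apply (continuity_1d_2d_pt_comp g (fun _ y => y))];
  auto using continuity_2d_pt_id1, continuity_2d_pt_id2.
- now split.
- split; [easy | split; [ | split; [ | split]]].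
  + apply ex_derive_mult; [apply Hf0 | apply ex_derive_const].
  + apply ex_derive_mult; [apply ex_derive_const | apply Hg0].
  + apply ex_diff_n_ext_loc with (fun x y => Derive f x * g y).
    * apply locally_2d_forall; intros x y; now rewrite Derive_scal_l.
    * apply IHn; [apply Hf | now apply Ck_S].
  + apply ex_diff_n_ext_loc with (fun x y => f x * Derive g y).
    * apply locally_2d_forall; intros x y; now rewrite Derive_scal.
    * apply IHn; [now apply Ck_S | apply Hg].
Qed.

Lemma surface_smooth m : 1 <= m -> smooth (surface m).
Proof.
intros Hm j n s t; split; apply ex_diff_n_mult; try now apply Ck_profile.
all: apply Ck_trig.
Qed.

(** * Angles *)

Definition cis (x : R) : C := (cos x, sin x).

Lemma cis_add x y : cis (x + y) = Cmult (cis x) (cis y).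
Proof. unfold cis, Cmult; simpl; rewrite cos_plus, sin_plus; f_equal; ring. Qed.

Lemma Cmod_cis x : Cmod (cis x) = 1.
Proof.
unfold Cmod, cis; simpl; rewrite !Rmult_1_r.
generalize (sin2_cos2 x); unfold Rsqr; rewrite Rplus_comm; intros ->; apply sqrt_1.
Qed.

Lemma cis_period x (n : Z) : cis (x + 2 * IZR n * PI) = cis x.
Proof.
assert (H : forall y (k : nat), cis (y + 2 * INR k * PI) = cis y).
{ intros y k; unfold cis; now rewrite cos_period, sin_period. }
destruct n as [ | p | p].
- f_equal; ring.
- replace (IZR (Z.pos p)) with (INR (Pos.to_nat p)) by now rewrite INR_IZR_INZ, positive_nat_Z.
  apply H.
- rewrite <- (H (x + 2 * IZR (Z.neg p) * PI) (Pos.to_nat p)); f_equal.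
  rewrite INR_IZR_INZ, positive_nat_Z, <- Pos2Z.opp_pos, opp_IZR; ring.
Qed.

(** The distance from e^{iz} to 1 is at least 1 - cos z, and cos decreases on [0, PI]. The integer
    is chosen before e, which lets [cis_inj] test it against e depending on it. *)
Lemma cis_close x y : exists n : Z, forall e, 0 < e <= PI ->
  Cmod (Cminus (cis y) (cis x)) < 1 - cos e -> Rabs (y - (x + 2 * IZR n * PI)) < e.
Proof.
(* The integer part of r is the number of turns that brings y - x into [-PI, PI). *)
set (r := (y - x + PI) / (2 * PI)).
assert (HPI := PI_RGT_0).
exists (Int_part r); intros e He Hc.
destruct (base_Int_part r) as [H1 H2].
set (n := Int_part r) in *.
set (z := y - (x + 2 * IZR n * PI)).
assert (Hz : z = 2 * PI * (r - IZR n) - PI) by (unfold z, r; field; lra).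
assert (Hy : cis y = Cmult (cis z) (cis x)).
{ rewrite <- cis_add, <- (cis_period (z + x) n); f_equal; unfold z; ring. }
assert (Hm : Cmod (Cminus (cis z) (RtoC 1)) < 1 - cos e).
{ eapply Rle_lt_trans; [right | exact Hc].
  transitivity (Cmod (Cmult (Cminus (cis z) (RtoC 1)) (cis x))).
  - rewrite Cmod_mult, Cmod_cis; ring.
  - rewrite Hy; f_equal; ring. }
assert (Hr := re_le_Cmod (Cminus (cis z) (RtoC 1))); simpl in Hr.
assert (Hcos : cos e < cos (Rabs z)).
{ replace (cos (Rabs z)) with (cos z).
  - apply Rabs_le_between in Hr; lra.
  - unfold Rabs; destruct (Rcase_abs z); [now rewrite cos_neg | easy]. }
apply cos_decreasing_0; try easy; try lra.
- apply Rabs_pos.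
- apply Rabs_le; nra.
Qed.

Lemma cis_inj x y : cis y = cis x -> exists n : Z, y = x + 2 * IZR n * PI.
Proof.
intros H; destruct (cis_close x y) as [n Hn]; exists n.
assert (HPI := PI_RGT_0).
destruct (Req_dec (y - (x + 2 * IZR n * PI)) 0) as [H0 | H0]; [lra | exfalso].
assert (Ha := Rabs_pos_lt _ H0); set (a := Rabs _) in *.
(* With this e, closeness would give a < min(a, PI), which is absurd. *)
assert (He : 0 < Rmin a PI <= PI) by (split; [now apply Rmin_glb_lt | apply Rmin_r]).
specialize (Hn _ He).
apply Rlt_not_le with (1 := Hn (ltac:(
  unfold Cminus; rewrite H, Cplus_opp_r, Cmod_0;
  assert (cos (Rmin a PI) < cos 0) by (apply cos_decreasing_1; lra);
  rewrite cos_0 in *; lra))).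
apply Rmin_l.
Qed.

(** From ab - cd = a (b - d) + (a - c) d; iterating it gives the Lipschitz bounds for powers and
    cubic monomials. *)
Lemma Cmod_mult_sub_le (a b c d : C) : Cmod a <= 1 -> Cmod d <= 1 ->
  Cmod (Cminus (Cmult a b) (Cmult c d)) <= Cmod (Cminus a c) + Cmod (Cminus b d).
Proof.
intros Ha Hd.
replace (Cminus (Cmult a b) (Cmult c d))
  with (Cplus (Cmult a (Cminus b d)) (Cmult (Cminus a c) d)) by ring.
eapply Rle_trans; [apply Cmod_triangle | rewrite !Cmod_mult].
generalize (Cmod_ge_0 (Cminus b d)) (Cmod_ge_0 (Cminus a c)); nra.
Qed.

Lemma cis_mult_close (k : nat) x y :
  Cmod (Cminus (cis (INR k * y)) (cis (INR k * x))) <= INR k * Cmod (Cminus (cis y) (cis x)).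
Proof.
induction k as [ | k IHk].
- simpl; rewrite !Rmult_0_l; unfold Cminus; rewrite Cplus_opp_r, Cmod_0; lra.
- rewrite S_INR, !Rmult_plus_distr_r, !Rmult_1_l, !cis_add.
  eapply Rle_trans; [apply Cmod_mult_sub_le; rewrite Cmod_cis; lra | lra].
Qed.

(** * Embeddedness *)

Lemma surface_polar m s t j :
  surface m s t j = Cmult (RtoC (profile m j s)) (cis (freq m j * t)).
Proof. unfold surface, wave, cis, Cmult, RtoC; simpl; f_equal; ring. Qed.

Lemma surface_periodic k : periodic (2 * PI) 0 0 (2 * PI) (surface (INR k)).
Proof.
intros s t m n j; rewrite !surface_polar, !Rmult_0_r, !Rplus_0_r.
assert (Hs : cis (s + IZR m * (2 * PI)) = cis s).
{ rewrite <- (cis_period s m); f_equal; ring. }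
assert (Hcos := f_equal fst Hs); assert (Hsin := f_equal snd Hs); simpl in Hcos, Hsin.
f_equal.
- unfold profile, quad; now rewrite Hcos, Hsin.
(* With an integer frequency z, n turns of t turn the phase z n times. *)
- assert (Hz : exists z, freq (INR k) j = IZR z).
  { destruct j; unfold freq; rewrite INR_IZR_INZ.
    - now exists (Z.of_nat k).
    - exists (Z.of_nat k + 1)%Z; now rewrite plus_IZR.
    - exists (- (2 * Z.of_nat k + 1))%Z; now rewrite opp_IZR, plus_IZR, mult_IZR. }
  destruct Hz as [z ->].
  rewrite <- (cis_period (IZR z * t) (z * n)), mult_IZR; f_equal; ring.
Qed.

Lemma Cmod_le_vnorm v j : Cmod (v j) <= vnorm v.
Proof.
apply sqrt_le_1_alt; unfold dot, sum_axis, Re, Im.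
generalize (pow2_ge_0 (fst (v ax1))) (pow2_ge_0 (snd (v ax1))) (pow2_ge_0 (fst (v ax2)))
  (pow2_ge_0 (snd (v ax2))) (pow2_ge_0 (fst (v ax3))) (pow2_ge_0 (snd (v ax3))).
destruct j; lra.
Qed.

Lemma Cmod_surface_le m s t j : 1 <= m -> Cmod (surface m s t j) <= 1.
Proof. intros Hm; rewrite <- (surface_in_unit_sphere m Hm s t); apply Cmod_le_vnorm. Qed.

Lemma cis_opp x : cis (- x) = Cconj (cis x).
Proof. unfold cis, Cconj; simpl; now rewrite cos_neg, sin_neg. Qed.

(* A polynomial in z and its conjugate which, restricted to the surface, is a
   positive multiple of e^{it}; this is how t is read off the image. *)
Definition angle_poly (z : C3) : C :=
  Cplus (Cconj (Cmult (Cmult (z ax1) (z ax1)) (z ax3))) (Cmult (Cmult (z ax2) (z ax2)) (z ax3)).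

Definition angle_weight (m s : R) : R :=
  profile m ax3 s * (profile m ax1 s * profile m ax1 s + profile m ax2 s * profile m ax2 s).

(** The phases match because -(2 a1 + a3) = 1 and 2 a2 + a3 = 1. *)
Lemma angle_poly_surface m s t :
  angle_poly (surface m s t) = Cmult (RtoC (angle_weight m s)) (cis t).
Proof.
unfold angle_poly, angle_weight; rewrite !surface_polar.
set (p := profile m); generalize (p ax1 s) (p ax2 s) (p ax3 s); intros x y z.
assert (H1 : cis t = Cconj (Cmult (Cmult (cis (freq m ax1 * t)) (cis (freq m ax1 * t))) (cis (freq m ax3 * t)))).
{ rewrite <- !cis_add, <- cis_opp; f_equal; unfold freq; ring. }
assert (H2 : cis t = Cmult (Cmult (cis (freq m ax2 * t)) (cis (freq m ax2 * t))) (cis (freq m ax3 * t))).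
{ rewrite <- !cis_add; f_equal; unfold freq; ring. }
transitivity (Cplus (Cmult (RtoC (z * (x * x))) (cis t)) (Cmult (RtoC (z * (y * y))) (cis t))).
- f_equal.
  + assert (Hc : forall r w, Cmult (RtoC r) (Cconj w) = Cconj (Cmult (RtoC r) w)).
    { intros r w; unfold Cmult, Cconj, RtoC; simpl; f_equal; ring. }
    rewrite H1, Hc; f_equal; rewrite !RtoC_mult; ring.
  + rewrite H2, !RtoC_mult; ring.
- rewrite !RtoC_mult, RtoC_plus, !RtoC_mult; ring.
Qed.

(** w3 is positive and the ellipse avoids the origin, so w1 and w2 never vanish together. *)
Lemma angle_weight_pos m s : 1 <= m -> 0 < angle_weight m s.
Proof.
intros Hm; apply Rmult_lt_0_compat; [now apply profile3_pos | ].
destruct (profile12_sqr m s Hm) as [-> ->].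
assert (0 < (2 * m + 1) / (3 * m + 1)) by (apply Rdiv_lt_0_compat; lra).
assert (0 < (2 * m + 1) / (3 * m + 2)) by (apply Rdiv_lt_0_compat; lra).
assert (Hs := sin_sqr_bounds s); destruct (Rle_lt_dec (sin s * sin s) (/ 2)); nra.
Qed.

(** Each of the two cubic monomials contributes 3d. *)
Lemma angle_poly_lipschitz (z w : C3) d :
  (forall j, Cmod (z j) <= 1) -> (forall j, Cmod (w j) <= 1) ->
  (forall j, Cmod (Cminus (z j) (w j)) <= d) ->
  Cmod (Cminus (angle_poly z) (angle_poly w)) <= 6 * d.
Proof.
intros Hz Hw Hd.
assert (Hcube : forall i j, Cmod (Cminus (Cmult (Cmult (z i) (z i)) (z j))
  (Cmult (Cmult (w i) (w i)) (w j))) <= 3 * d).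
{ intros i j; eapply Rle_trans; [apply Cmod_mult_sub_le | ].
  - rewrite Cmod_mult; generalize (Hz i) (Cmod_ge_0 (z i)); nra.
  - apply Hw.
  - generalize (Cmod_mult_sub_le (z i) (z i) (w i) (w i) (Hz i) (Hw i)) (Hd i) (Hd j); lra. }
unfold angle_poly.
match goal with |- Cmod (Cminus (Cplus (Cconj ?a) ?b) (Cplus (Cconj ?c) ?e)) <= _ =>
  replace (Cminus (Cplus (Cconj a) b) (Cplus (Cconj c) e))
    with (Cplus (Cconj (Cminus a c)) (Cminus b e)) by (rewrite Cminus_conj; ring)
end.
eapply Rle_trans; [apply Cmod_triangle | rewrite Cmod_conj].
generalize (Hcube ax1 ax3) (Hcube ax2 ax3); lra.
Qed.

(** The triangle inequality bounds |b - a| by d, and a (e^{iy} - e^{ix}) differs from the given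
    difference by (a - b) e^{iy}. The constant involves a alone, so b may belong to an unknown
    nearby point. *)
Lemma cis_Lipschitz_of_scaled a b x y d : 0 < a -> 0 < b ->
  Cmod (Cminus (Cmult (RtoC b) (cis y)) (Cmult (RtoC a) (cis x))) <= d ->
  Cmod (Cminus (cis y) (cis x)) <= 2 / a * d.
Proof.
intros Ha Hb Hd.
assert (Hm : forall r z, 0 < r -> Cmod (Cmult (RtoC r) (cis z)) = r).
{ intros r z Hr; rewrite Cmod_mult, Cmod_cis, Cmod_R, Rabs_pos_eq; lra. }
assert (Hab : Rabs (b - a) <= d).
{ apply Rabs_le; split.
  - assert (H := Cmod_triangle (Cminus (Cmult (RtoC a) (cis x)) (Cmult (RtoC b) (cis y)))
      (Cmult (RtoC b) (cis y))).
    rewrite <- Cmod_opp in Hd.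
    replace (Copp _) with (Cminus (Cmult (RtoC a) (cis x)) (Cmult (RtoC b) (cis y))) in Hd by ring.
    replace (Cplus _ _) with (Cmult (RtoC a) (cis x)) in H by ring.
    rewrite !Hm in H by easy; lra.
  - assert (H := Cmod_triangle (Cminus (Cmult (RtoC b) (cis y)) (Cmult (RtoC a) (cis x)))
      (Cmult (RtoC a) (cis x))).
    replace (Cplus _ _) with (Cmult (RtoC b) (cis y)) in H by ring.
    rewrite !Hm in H by easy; lra. }
apply Rmult_le_reg_l with a; [easy | ].
replace (a * (2 / a * d)) with (2 * d) by (field; lra).
replace (a * Cmod (Cminus (cis y) (cis x))) with (Cmod (Cmult (RtoC a) (Cminus (cis y) (cis x))))
  by (rewrite Cmod_mult, Cmod_R, Rabs_pos_eq; lra).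
replace (Cmult (RtoC a) (Cminus (cis y) (cis x)))
  with (Cplus (Cminus (Cmult (RtoC b) (cis y)) (Cmult (RtoC a) (cis x)))
              (Cmult (RtoC (a - b)) (cis y))) by (rewrite RtoC_minus; ring).
eapply Rle_trans; [apply Cmod_triangle | ].
rewrite Cmod_mult, Cmod_cis, Cmod_R, Rabs_minus_sym; lra.
Qed.

(** A signed real amplitude is recovered by undoing its phase; taking moduli would lose the sign. *)
Lemma scaled_real_close (k : nat) a p q x y d c :
  Cmod (Cmult (RtoC p) (cis (INR k * x))) <= 1 ->
  Cmod (Cminus (Cmult (RtoC q) (cis (INR k * y))) (Cmult (RtoC p) (cis (INR k * x)))) <= d ->
  Cmod (Cminus (cis y) (cis x)) <= c ->
  0 < a -> Rabs (q / a - p / a) <= (d + INR k * c) / a.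
Proof.
intros Hp Hd Hc Ha.
assert (Hr : forall r z, RtoC r = Cmult (Cconj (cis z)) (Cmult (RtoC r) (cis z))).
{ intros r z; rewrite <- cis_opp.
  transitivity (Cmult (RtoC r) (cis (z + - z))).
  - rewrite Rplus_opp_r; unfold cis; rewrite cos_0, sin_0.
    unfold Cmult, RtoC; simpl; f_equal; ring.
  - rewrite cis_add; ring. }
replace (q / a - p / a) with ((q - p) / a) by (field; lra).
rewrite Rabs_div, (Rabs_pos_eq a) by lra.
apply Rmult_le_compat_r; [now apply Rlt_le, Rinv_0_lt_compat | ].
rewrite <- Cmod_R, RtoC_minus, (Hr q (INR k * y)), (Hr p (INR k * x)).
eapply Rle_trans; [apply Cmod_mult_sub_le | ].
- rewrite Cmod_conj, Cmod_cis; lra.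
- easy.
- rewrite <- Cminus_conj, Cmod_conj.
  generalize (cis_mult_close k x y) (pos_INR k); nra.
Qed.

(** First e^{it} is read off through [angle_poly]; undoing the phases of the first two coordinates
    then yields cos s and sin s. The constant depends on the base point. *)
Lemma surface_inverse_lipschitz k s t : (1 <= k)%nat ->
  exists c, 0 < c /\ forall s' t',
    let d := vnorm (vadd (surface (INR k) s' t') (vopp (surface (INR k) s t))) in
    Cmod (Cminus (cis s') (cis s)) <= c * d /\ Cmod (Cminus (cis t') (cis t)) <= c * d.
Proof.
intros Hk; apply le_INR in Hk; simpl in Hk.
assert (HR := angle_weight_pos (INR k) s Hk).
assert (Ha : 0 < sqrt ((2 * INR k + 1) / (3 * INR k + 1))) by (apply sqrt_lt_R0, Rdiv_lt_0_compat; lra).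
assert (Hb : 0 < sqrt ((2 * INR k + 1) / (3 * INR k + 2))) by (apply sqrt_lt_R0, Rdiv_lt_0_compat; lra).
(* The factor 6 of [angle_poly_lipschitz] times the factor 2 / weight of
   [cis_Lipschitz_of_scaled]. *)
set (c0 := 12 / angle_weight (INR k) s).
assert (Hc0 : 0 < c0) by (apply Rdiv_lt_0_compat; lra).
set (a := sqrt ((2 * INR k + 1) / (3 * INR k + 1))) in *.
set (b := sqrt ((2 * INR k + 1) / (3 * INR k + 2))) in *.
(* The factors k and k + 1 are the frequencies of the first two coordinates, by which an error in t
   is magnified. *)
set (c1 := (1 + INR k * c0) / a); set (c2 := (1 + INR (S k) * c0) / b).
assert (Hc1 : 0 < c1) by (apply Rdiv_lt_0_compat; nra).
assert (Hc2 : 0 < c2) by (apply Rdiv_lt_0_compat; [rewrite S_INR; nra | easy]).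
exists (c0 + c1 + c2); split; [lra | ]; intros s' t' d.
assert (Hd0 : 0 <= d) by apply sqrt_pos.
assert (Hd : forall j, Cmod (Cminus (surface (INR k) s' t' j) (surface (INR k) s t j)) <= d)
  by (intros j; apply (Cmod_le_vnorm (vadd _ (vopp _)))).
assert (H1 := fun s t j => Cmod_surface_le (INR k) s t j Hk).
assert (Ht : Cmod (Cminus (cis t') (cis t)) <= c0 * d).
{ replace (c0 * d) with (2 / angle_weight (INR k) s * (6 * d)) by (unfold c0; field; lra).
  apply cis_Lipschitz_of_scaled with (angle_weight (INR k) s'); [easy | now apply angle_weight_pos | ].
  rewrite <- !angle_poly_surface; now apply angle_poly_lipschitz. }
split; [ | nra].
assert (Hcos : Rabs (cos s' - cos s) <= c1 * d).
{ replace (c1 * d) with ((d + INR k * (c0 * d)) / a) by (unfold c1; field; lra).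
  replace (cos s' - cos s) with (a * cos s' / a - a * cos s / a) by (field; lra).
  apply scaled_real_close with t t'; try easy.
  - generalize (H1 s t ax1); now rewrite surface_polar.
  - generalize (Hd ax1); now rewrite !surface_polar. }
assert (Hsin : Rabs (sin s' - sin s) <= c2 * d).
{ replace (c2 * d) with ((d + INR (S k) * (c0 * d)) / b) by (unfold c2; field; lra).
  replace (sin s' - sin s) with (b * sin s' / b - b * sin s / b) by (field; lra).
  apply scaled_real_close with t t'; try easy; rewrite S_INR.
  - generalize (H1 s t ax2); now rewrite surface_polar.
  - generalize (Hd ax2); now rewrite !surface_polar. }
replace (Cminus (cis s') (cis s))
  with (Cplus (RtoC (cos s' - cos s)) (Cmult Ci (RtoC (sin s' - sin s))))
  by (unfold Cminus, Cplus, Copp, Cmult, Ci, RtoC, cis; simpl; f_equal; ring).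
eapply Rle_trans; [apply Cmod_triangle | ].
rewrite Cmod_mult, Cmod_Ci, !Cmod_R; nra.
Qed.

Lemma surface_injective k : (1 <= k)%nat ->
  injective_mod (2 * PI) 0 0 (2 * PI) (surface (INR k)).
Proof.
intros Hk s t s' t' H.
destruct (surface_inverse_lipschitz k s t Hk) as (c & Hc & Hl).
specialize (Hl s' t'); simpl in Hl.
(* Injectivity is the case of distance zero in the Lipschitz estimate. *)
replace (vnorm _) with 0 in Hl.
2: { unfold vnorm, dot, sum_axis, vadd, vopp; rewrite !H, !Cplus_opp_r; unfold Re, Im; simpl.
  symmetry; etransitivity; [ | exact sqrt_0]; f_equal; ring. }
rewrite !Rmult_0_r in Hl; destruct Hl as [Hs Ht].
assert (Heq : forall x y : C, Cmod (Cminus y x) <= 0 -> y = x).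
{ intros x y Hxy; replace y with (Cplus (Cminus y x) x) by ring.
  rewrite (Cmod_eq_0 (Cminus y x)) by (generalize (Cmod_ge_0 (Cminus y x)); lra); ring. }
destruct (cis_inj _ _ (Heq _ _ Hs)) as [m Hm].
destruct (cis_inj _ _ (Heq _ _ Ht)) as [n Hn].
exists m, n; lra.
Qed.

Lemma surface_inverse_continuous k : (1 <= k)%nat ->
  inverse_continuous_mod (2 * PI) 0 0 (2 * PI) (surface (INR k)).
Proof.
intros Hk s t eps.
destruct (surface_inverse_lipschitz k s t Hk) as (c & Hc & Hl).
assert (HPI := PI_RGT_0).
(* The cap at PI puts e in the range of [cis_close]; its threshold 1 - cos e, divided by the
   Lipschitz constant, is the required radius. *)
set (e := Rmin eps PI).
assert (He : 0 < e <= PI) by (split; [apply Rmin_glb_lt; [apply eps | easy] | apply Rmin_r]).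
assert (Hle : e <= eps) by apply Rmin_l.
assert (Hcos : cos e < cos 0) by (apply cos_decreasing_1; lra); rewrite cos_0 in Hcos.
assert (Hdelta : 0 < (1 - cos e) / c) by (apply Rdiv_lt_0_compat; lra).
exists (mkposreal _ Hdelta); intros s' t' Hd; simpl in Hd.
destruct (Hl s' t') as [Hs Ht].
apply Rlt_div_r in Hd; [ | easy]; rewrite Rmult_comm in Hd.
destruct (cis_close s s') as [m Hm]; destruct (cis_close t t') as [n Hn].
exists m, n.
replace (s + IZR m * (2 * PI) + IZR n * 0) with (s + 2 * IZR m * PI) by ring.
replace (t + IZR m * 0 + IZR n * (2 * PI)) with (t + 2 * IZR n * PI) by ring.
split; (eapply Rlt_le_trans; [ | exact Hle]).
- apply Hm; [easy | lra].
- apply Hn; [easy | lra].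
Qed.

Lemma surface_embedded_torus k : (1 <= k)%nat -> embedded_torus (surface (INR k)).
Proof.
intros Hk; assert (Hm := le_INR _ _ Hk); simpl in Hm.
split; [now apply surface_smooth | split; [now apply surface_immersion | ]].
exists (2 * PI), 0, 0, (2 * PI); split; [generalize PI_RGT_0; nra | ].
split; [apply surface_periodic | split].
- now apply surface_injective.
- now apply surface_inverse_continuous.
Qed.

Theorem theorem5p5 :
  forall eps : R, 0 < eps ->
    exists F : R -> R -> C3,
      embedded_torus F /\
      in_unit_sphere F /\
      minimal F /\
      legendrian F /\
      ~ flat F /\
      Rbar_lt (sup_abs_curvature F) (Finite eps).
Proof.
intros eps Heps.
(* Here k eps > 10, so 10 / (k + 1) < eps; the successor makes the parameter visibly at least 1. *)
destruct (INR_archimed eps 10 Heps) as [k Hk].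
assert (Hm : 1 <= INR (S k)) by (rewrite S_INR; generalize (pos_INR k); lra).
exists (surface (INR (S k))).
split; [apply surface_embedded_torus; lia | ].
split; [now apply surface_in_unit_sphere | ].
split; [now apply surface_minimal | ].
split; [now apply surface_legendrian | ].
split; [now apply surface_not_flat | ].
eapply Rbar_le_lt_trans; [now apply surface_sup_abs_curvature | ].
change (10 / INR (S k) < eps); rewrite S_INR in *; apply Rlt_div_l; [lra | ]. lra.
Qed.
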